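(* Let $\mathcal S$ be a complete separable metric space, $a,\rho,k>0$, and let $N$ be a point process on $\mathcal S$ such that (I) $N$ is almost surely boundedly finite and has no fixed atoms (i.e. $P\{N(\{x\})>0\}=0$ for every $x\in\mathcal S$); and (II) there is a function $m$ from the bounded Borel sets of $\mathcal S$ to $[0,\infty)$ such that for every finite family of pairwise disjoint bounded Borel sets $A_1,\dots,A_l$, the vector $(N(A_1),\dots,N(A_l))$ has the $\mathrm{MGWD}(a;k\,m(A_1),\dots,k\,m(A_l);\rho)$ distribution. Then there exists a boundedly finite nonatomic Borel measure $\mu$ on $\mathcal S$ with $\mu(A)=m(A)$ and $$P_0(A):=P\{N(A)=0\}=\frac{\rho_{(k\mu(A))}}{(\rho+a)_{(k\mu(A))}}$$ for every bounded Borel set $A$.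
   Context: For $x>0$, $\beta\ge0$ write $x_{(\beta)}=\Gamma(x+\beta)/\Gamma(x)$, with $0_{(0)}=1$ and $0_{(n)}=0$ for integers $n\ge1$. For $a,\rho>0$ and $k_1,\dots,k_s\ge 0$, $\mathrm{MGWD}(a;k_1,\dots,k_s;\rho)$ denotes the law on $\{0,1,2,\dots\}^s$ with $P(X_i=x_i,\ i=1,\dots,s)=\frac{\rho_{(\sum_i k_i)}\,a_{(\sum_i x_i)}}{(\rho+a)_{(\sum_i k_i+\sum_i x_i)}}\prod_{i=1}^s\frac{(k_i)_{(x_i)}}{x_i!}$. *)

(* Defs.v *)
From HB Require Import structures.
From mathcomp Require Import all_boot all_order all_algebra.
From mathcomp Require Import all_classical all_reals all_analysis.
From mathcomp Require Import measurable_realfun.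
Set Implicit Arguments. Unset Strict Implicit. Unset Printing Implicit Defensive.
Import Order.TTheory GRing.Theory Num.Theory.
Import numFieldNormedType.Exports.
Local Open Scope classical_set_scope.
Local Open Scope ring_scope.

Definition GammaR (R : realType) (x : R) : R :=
  fine (\int[@lebesgue_measure R]_(t in `]0%R, +oo[%classic)
          ((powR t (x - 1)) * expR (- t))%:E)%E.

Definition rising (R : realType) (x beta : R) : R :=
  if x == 0 then (if beta == 0 then 1 else 0)
  else GammaR (x + beta) / GammaR x.

Definition mgwd_pmf (R : realType) (s : nat) (a : R) (k : 'I_s -> R) (rho : R)
    (x : 'I_s -> nat) : R :=
  rising rho (\sum_(i < s) k i) * rising a (\sum_(i < s) (x i)%:R)
  / rising (rho + a) (\sum_(i < s) k i + \sum_(i < s) (x i)%:R)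
  * \prod_(i < s) (rising (k i) (x i)%:R / ((x i)`!)%:R).

(* metric spaces carrying a distinguished point (mathcomp-analysis requires
   measurable types to be pointed, i.e. nonempty) *)
#[short(type="pmetricType")]
HB.structure Definition PointedMetric (K : numDomainType) :=
  { M of Pointed M & Metric K M }.

Definition BorelT (R : realType) (S : pmetricType R) := g_sigma_algebraType (@open S).

Definition Borel (R : realType) (S : pmetricType R) (A : set S) : Prop :=
  measurable (A : set (BorelT S)).

Definition mbounded (R : realType) (S : pmetricType R) (A : set S) : Prop :=
  exists (x0 : S) (r : R), A `<=` [set y | mdist x0 y < r].

Definition bBorel (R : realType) (S : pmetricType R) (A : set S) : Prop :=
  Borel A /\ mbounded A.

Definition complete_space (R : realType) (S : pmetricType R) : Prop :=
  forall F : set_system S, ProperFilter F -> cauchy F -> cvg F.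

Definition separable_space (R : realType) (S : pmetricType R) : Prop :=
  exists D : set S, countable D /\ dense D.

Definition point_process (R : realType) (S : pmetricType R) (d : measure_display)
    (Omega : measurableType d)
    (N : Omega -> {measure set (BorelT S) -> \bar R}) : Prop :=
  (forall w (A : set (BorelT S)), measurable A ->
      (exists n : nat, N w A = (n%:R)%:E) \/ N w A = +oo%E) /\
  (forall A : set (BorelT S), measurable A ->
      measurable_fun [set: Omega] (fun w => (N w A : \bar R))).

(* Main.v *)
(* The ratio phi(t) = rho_(t) / (rho + a)_(t) of gamma functions is strictly
   decreasing in t, by strict log-convexity of Gamma in the form of Chebyshev's
   association inequality for the gamma density. Evaluating the MGWD laws at the
   origin gives P(N(A_1) = ... = N(A_l) = 0) = phi(k (m(A_1) + ... + m(A_l))) for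
   disjoint A_i. If A is the disjoint union of the A_i, the events
   {N(A_1) = ... = N(A_n) = 0} decrease to {N(A) = 0}, so phi(k m(A)) is the limit
   of phi(k (m(A_1) + ... + m(A_n))), and strict monotonicity turns this into
   m(A) = sum_i m(A_i). Thus m is countably additive on bounded Borel sets and
   extends to a measure; absence of fixed atoms means phi(k m({x})) = 1 = phi(0),
   that is m({x}) = 0. *)
Require Import Defs.
From HB Require Import structures.
From mathcomp Require Import all_boot all_order all_algebra.
From mathcomp Require Import all_classical all_reals all_analysis.
From mathcomp Require Import measurable_realfun.
From mathcomp Require Import ring lra.
Set Implicit Arguments.
Unset Strict Implicit.
Unset Printing Implicit Defensive.
Import Order.TTheory GRing.Theory Num.Theory.
Import numFieldNormedType.Exports.
Local Open Scope classical_set_scope.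
Local Open Scope ring_scope.

(** * An integrable majorant of the gamma density *)

Section GammaFunction.
Context {R : realType}.
Implicit Types x t c : R.
Local Notation leb := (@lebesgue_measure R).

Definition gamma_kernel x t : R := t `^ (x - 1) * expR (- t).

Lemma measurable_gamma_kernel x (D : set R) :
  measurable_fun D (gamma_kernel x).
Proof.
apply: (@measurable_funTS _ _ _ _ D).
apply: measurable_funM; first exact: measurable_powR.
by apply: measurableT_comp => //; exact: measurable_funN.
Qed.

Lemma gamma_kernel_gt0 x t : 0 < t -> 0 < gamma_kernel x t.
Proof. by move=> t0; rewrite mulr_gt0// ?powR_gt0// expR_gt0. Qed.

(** This is ln u < u at u = t / (2x), multiplied by x and exponentiated; the scale 2x makes the
    exponent t / 2, so that half of the decay of exp(-t) is left over. *)
Lemma powR_le_expR x t : 0 < x -> 0 < t ->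
  t `^ x <= (2 * x) `^ x * expR (t / 2).
Proof.
move=> x0 t0; have x20 : 0 < 2 * x by rewrite mulr_gt0.
rewrite {1}(_ : t = (2 * x) * (t / (2 * x))); last first.
  by rewrite mulrCA divff ?mulr1// gt_eqF.
rewrite (@powRM _ (2 * x)) ?(ltW x20) ?(ltW (divr_gt0 _ _))// ler_wpM2l ?powR_ge0//.
rewrite /powR gt_eqF ?divr_gt0// ler_expR.
have := ln_sublinear (divr_gt0 t0 x20).
have -> : t / 2 = x * (t / (2 * x)) by field; rewrite gt_eqF.
by move=> /ltW; rewrite ler_pM2l.
Qed.

(* The antiderivative of the right-hand side is bounded on the half-line. *)
Lemma gamma_kernel_le x t : 0 < x -> 0 < t ->
  gamma_kernel x t <= (1 + (2 * x) `^ x) ^+ 2 / x *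
    (x * t `^ (x - 1) / (1 + t `^ x) ^+ 2).
Proof.
move=> x0 t0; rewrite /gamma_kernel.
have px := powR_ge0 t x.
have p0 : 0 < (1 + t `^ x) ^+ 2 by rewrite exprn_gt0// ltr_wpDr.
set K := 1 + _.
rewrite (_ : K ^+ 2 / x * _ = t `^ (x - 1) * (K ^+ 2 / (1 + t `^ x) ^+ 2)); last first.
  by field; rewrite (gt_eqF x0) gt_eqF// ltr_wpDr.
rewrite ler_wpM2l ?powR_ge0// ler_pdivlMr// expRN mulrC ler_pdivrMr ?expR_gt0//.
(* Both sides become squares, so it suffices that 1 + t^x <= K exp(t/2), the sum of [powR_le_expR]
   and 1 <= exp(t/2). *)
rewrite (_ : expR t = expR (t / 2) ^+ 2); last by rewrite -expRM_natl mulrCA divff ?mulr1.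
rewrite -exprMn ler_sqr ?nnegrE.
- rewrite mulrDl mul1r lerD ?powR_le_expR//.
  by rewrite -[leLHS]expR0 ler_expR divr_ge0// ltW.
- by rewrite addr_ge0.
- by rewrite mulr_ge0 ?expR_ge0// addr_ge0// powR_ge0.
Qed.

Lemma is_derive_logistic x t : 0 < t ->
  is_derive t 1 (fun u : R => - (1 + u `^ x)^-1)
    (x * t `^ (x - 1) / (1 + t `^ x) ^+ 2).
Proof.
move=> t0; have p0 : 1 + t `^ x != 0 by rewrite gt_eqF// ltr_wpDr// powR_ge0.
have dp := is_derive1_powR x t0.
have d1 : is_derive t 1 (fun u : R => 1 + u `^ x) (x * t `^ (x - 1)).
  by rewrite -[X in is_derive _ _ _ X]add0r; exact: is_deriveD.
rewrite [X in is_derive _ _ _ X](_ : _ =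
    - (- (1 + t `^ x) ^- 2 *: (x * t `^ (x - 1)))).
  exact/is_deriveN/is_deriveV.
by rewrite scaleNr opprK mulrC.
Qed.

Lemma continuous_gamma_majorant x t : 0 < t ->
  {for t, continuous (fun u : R => x * u `^ (x - 1) / (1 + u `^ x) ^+ 2)}.
Proof.
move=> t0; have cp p : {for t, continuous (fun u : R => u `^ p)}.
  by apply/differentiable_continuous/derivable1_diffP; case: (is_derive1_powR p t0).
apply: continuousM; first by apply: continuousM; [exact: cst_continuous|exact: cp].
apply: continuousV.
  by rewrite expf_neq0// gt_eqF// ltr_wpDr// powR_ge0.
apply: (@continuous_comp _ _ _ (fun u : R => 1 + u `^ x) (fun v : R => v ^+ 2)).
  by apply: continuousD; [exact: cst_continuous|exact: cp].
exact: exprn_continuous.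
Qed.

(** The antiderivative takes values in [-1, 0], so its increments are at most 1 whatever u and v; u
    > 0 keeps away from the singularity of t^(x-1) at 0 when x < 1. *)
Lemma integral_gamma_majorant_le1 x (u v : R) : 0 < u -> u < v ->
  (\int[leb]_(t in `[u, v]) (x * t `^ (x - 1) / (1 + t `^ x) ^+ 2)%:E <= 1%:E)%E.
Proof.
move=> u0 uv.
pose H (t : R) := - (1 + t `^ x)^-1.
have cH t : 0 < t -> {for t, continuous H}.
  move=> t0; apply/differentiable_continuous/derivable1_diffP.
  by case: (is_derive_logistic x t0).
rewrite (@continuous_FTC2 _ _ H)//.
- rewrite -EFinB lee_fin /H opprK.
  have h t : 0 <= (1 + t `^ x)^-1 <= 1.
    rewrite invr_ge0 addr_ge0 ?powR_ge0//=.
    by rewrite invf_le1 ?lerDl ?powR_ge0// ltr_wpDr// powR_ge0.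
  by have := h u; have := h v; lra.
- apply: continuous_in_subspaceT => t; rewrite inE/= in_itv/= => /andP[ut _].
  exact/continuous_gamma_majorant/(lt_le_trans u0).
- split.
  + move=> t; rewrite in_itv/= => /andP[ut _].
    by case: (is_derive_logistic x (lt_trans u0 ut)).
  + exact/cvg_at_right_filter/cH.
  + exact/cvg_at_left_filter/cH/(lt_trans u0).
- move=> t; rewrite in_itv/= => /andP[ut _].
  by rewrite derive1E; case: (is_derive_logistic x (lt_trans u0 ut)).
Qed.
End GammaFunction.

(** * Strictly positive integrals and an abstract association inequality *)

Section RintegralPositive.
Context d (T : measurableType d) (R : realType) (mu : {measure set T -> \bar R}).

(** A nonnegative function with zero integral vanishes almost everywhere, which would make [E]
    null. *)
Lemma Rintegral_gt0 (D E : set T) (f : T -> R) :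
  measurable D -> measurable E -> E `<=` D -> (0 < mu E)%E ->
  mu.-integrable D (EFin \o f) ->
  (forall t, D t -> 0 <= f t) -> (forall t, E t -> 0 < f t) ->
  0 < \int[mu]_(t in D) f t.
Proof.
move=> mD mE ED muE0 intf f0 Ef0.
rewrite lt_neqAle Rintegral_ge0// andbT; apply/eqP => /esym If0.
have /integrableP[mf _] := intf.
have : (\int[mu]_(t in D) `|(EFin \o f) t| = 0)%E.
  rewrite (eq_integral (EFin \o f)); last first.
    by move=> t; rewrite inE => /f0 ft0; rewrite /= ger0_norm.
  by rewrite -[LHS]fineK ?integrable_fin_num//; congr EFin.
move/(ae_eq_integral_abs mu mD mf) => [M [mM M0 DM]].
suff : (mu E <= 0)%E by rewrite leNgt muE0.
rewrite -M0 le_measure ?inE// => t Et; apply: DM => /= /(_ (ED _ Et))[ft0].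
by have := Ef0 _ Et; rewrite ft0 ltxx.
Qed.

(* The left-hand side of [rE] makes the two terms with factor [q] cancel. *)
Lemma lt_Rintegral_association (D E : set T) (w wu wv wuv : T -> R) (r q : R) :
  measurable D -> measurable E -> E `<=` D -> (0 < mu E)%E ->
  mu.-integrable D (EFin \o w) -> mu.-integrable D (EFin \o wu) ->
  mu.-integrable D (EFin \o wv) -> mu.-integrable D (EFin \o wuv) ->
  r * (\int[mu]_(t in D) w t) = \int[mu]_(t in D) wu t ->
  (forall t, D t -> 0 <= wuv t - q * wu t - (r * wv t - r * q * w t)) ->
  (forall t, E t -> 0 < wuv t - q * wu t - (r * wv t - r * q * w t)) ->
  r * (\int[mu]_(t in D) wv t) < \int[mu]_(t in D) wuv t.
Proof.
move=> mD mE ED muE0 iw iwu iwv iwuv rE ge0 gt0.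
have iZ s f : mu.-integrable D (EFin \o f) ->
    mu.-integrable D (EFin \o (fun t => s * f t)).
  by move=> intf; exact: (integrableZl mD s intf).
have iB f g : mu.-integrable D (EFin \o f) -> mu.-integrable D (EFin \o g) ->
    mu.-integrable D (EFin \o (fun t => f t - g t)).
  by move=> intf intg; exact: (integrableB mD intf intg).
(* Reading [wu], [wv], [wuv] as products, the integrand is the expansion of (u - r)(v - q)w. *)
have := @Rintegral_gt0 D E _ mD mE ED muE0
  (iB _ _ (iB _ _ iwuv (iZ q _ iwu)) (iB _ _ (iZ r _ iwv) (iZ (r * q) _ iw))) ge0 gt0.
have i1 := iZ q _ iwu; have i2 := iZ r _ iwv; have i3 := iZ (r * q) _ iw.
rewrite RintegralB//; [|exact: iB|exact: iB].
by rewrite !RintegralB// !RintegralZl// -rE; lra.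
Qed.

End RintegralPositive.

(** * Positivity of Gamma and strict decrease of the ratio of rising factorials *)

Section GammaMonotonicity.
Context {R : realType}.
Implicit Types x t c : R.
Local Notation leb := (@lebesgue_measure R).

Lemma integral_gamma_kernel_lty x : 0 < x ->
  (\int[leb]_(t in `]0%R, +oo[%classic) (gamma_kernel x t)%:E < +oo)%E.
Proof.
move=> x0; pose C := (1 + (2 * x) `^ x) ^+ 2 / x.
have C0 : 0 <= C by rewrite divr_ge0 ?sqr_ge0// ltW.
(* With n + 1 in place of n + 2 the interval at n = 0 would be a single point, while the bound on
   the majorant asks for u < v. *)
pose F (n : nat) : set R := `[n.+2%:R^-1, n.+2%:R]%classic.
have mF n : measurable (F n) by exact: measurable_itv.
have F0 n t : F n t -> 0 < t.
  by rewrite /F/= in_itv/= => /andP[+ _]; apply: lt_le_trans; rewrite invr_gt0.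
have -> : `]0%R, +oo[%classic = \bigcup_n F n :> set R.
  apply/seteqP; split => [t|t [n _ /F0]]; rewrite /= in_itv/= andbT//.
  (* The successor of this truncation exceeds both t and 1/t. *)
  move=> t0; exists (Num.trunc (t + t^-1)) => //; rewrite /F/= in_itv/=.
  have tt := ltW (truncnS_gt (t + t^-1)).
  have le2 : (Num.trunc (t + t^-1)).+1%:R <= (Num.trunc (t + t^-1)).+2%:R :> R.
    by rewrite ler_nat.
  have tV : 0 < t^-1 by rewrite invr_gt0.
  rewrite -[X in _ <= X <= _]invrK lef_pV2 ?posrE// invrK.
  by apply/andP; split; lra.
have FI n : (\int[leb]_(t in F n) (gamma_kernel x t)%:E <= C%:E)%E.
  have mmaj : measurable_fun (F n)
      (fun t => (x * t `^ (x - 1) / (1 + t `^ x) ^+ 2)).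
    apply: subspace_continuous_measurable_fun => //.
    suff : {within F n, continuous
        (fun t => x * t `^ (x - 1) / (1 + t `^ x) ^+ 2)} by [].
    apply: continuous_in_subspaceT => t; rewrite inE => /F0.
    exact: continuous_gamma_majorant.
  have maj0 t : 0 <= x * t `^ (x - 1) / (1 + t `^ x) ^+ 2.
    by rewrite divr_ge0 ?sqr_ge0// mulr_ge0 ?powR_ge0// ltW.
  apply: (@le_trans _ _ (\int[leb]_(t in F n)
      (C%:E * (x * t `^ (x - 1) / (1 + t `^ x) ^+ 2)%:E))%E).
    apply: ge0_le_integral => //; first exact: mF.
    - by move=> t /F0 t0; rewrite lee_fin ltW// gamma_kernel_gt0.
    - by apply/measurable_EFinP; exact: measurable_gamma_kernel.
    - by apply/measurable_EFinP; exact: measurable_funM.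
    - by move=> t /F0 t0; rewrite -EFinM lee_fin gamma_kernel_le.
  rewrite ge0_integralZl//; last 3 first.
  - exact: mF.
  - exact/measurable_EFinP.
  - by move=> t _; rewrite lee_fin.
  rewrite -[leRHS]mule1 lee_wpmul2l// integral_gamma_majorant_le1 ?invr_gt0//.
  by rewrite (@lt_trans _ _ 1) ?invf_lt1 ?ltr1n.
apply: (@le_lt_trans _ _ C%:E)%E; last exact: ltry.
(* Monotone convergence carries the uniform bound C from the intervals to the half-line. *)
have Fcvg : (\int[leb]_(t in F i) (gamma_kernel x t)%:E @[i --> \oo] -->
    \int[leb]_(t in \bigcup_i F i) (gamma_kernel x t)%:E)%E.
  apply: ge0_nondecreasing_set_cvg_integral => //.
  - move=> n p np; apply/subsetPset => t; rewrite /F/= !in_itv/= => /andP[nt tn].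
    rewrite (le_trans tn) ?ler_nat ?ltnS// andbT (le_trans _ nt)//.
    by rewrite lef_pV2 ?posrE// ler_nat !ltnS.
  - by move=> n; by apply/measurable_EFinP; exact: measurable_gamma_kernel.
  - by move=> n t /F0 t0; rewrite lee_fin ltW// gamma_kernel_gt0.
rewrite -(cvg_lim _ Fcvg)//; apply: lime_le; first by apply/cvg_ex; eexists; exact: Fcvg.
exact: nearW.
Qed.

Lemma integrable_gamma_kernel x : 0 < x ->
  leb.-integrable `]0%R, +oo[ (EFin \o gamma_kernel x).
Proof.
move=> x0; apply/integrableP; split.
  by apply/measurable_EFinP; exact: measurable_gamma_kernel.
apply: le_lt_trans (integral_gamma_kernel_lty x0).
rewrite le_eqVlt; apply/orP; left; apply/eqP/eq_integral => t.
rewrite inE/= in_itv/= andbT => t0.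
by rewrite gtr0_norm// gamma_kernel_gt0.
Qed.

Lemma lebesgue_measure_itvy_gt0 c : (0 < leb `]c, +oo[)%E.
Proof. by rewrite lebesgue_measure_itv/= ltry addye// ltry. Qed.

Lemma GammaR_gt0 x : 0 < x -> 0 < GammaR x.
Proof.
move=> x0; apply: (@Rintegral_gt0 _ _ _ leb _ `]0%R, +oo[ (gamma_kernel x)) => //.
- exact: lebesgue_measure_itvy_gt0.
- exact: integrable_gamma_kernel.
- by move=> t; rewrite /= in_itv/= andbT => /(gamma_kernel_gt0 x)/ltW.
- by move=> t; rewrite /= in_itv/= andbT => /(gamma_kernel_gt0 x).
Qed.

Lemma gamma_kernelD x p t : 0 < t ->
  gamma_kernel (x + p) t = t `^ p * gamma_kernel x t.
Proof.
move=> t0; rewrite /gamma_kernel mulrA -powRD ?(gt_eqF t0) ?implybT//.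
by congr (_ `^ _ * _); ring.
Qed.

(* Chebyshev's association inequality for the increasing functions [t ^ a] and
   [t ^ b] under the gamma density. The level [c] is chosen so that [c ^ a] is
   the mean of [t ^ a]. *)
Lemma GammaR_cross_lt x (a b : R) : 0 < x -> 0 < a -> 0 < b ->
  GammaR (x + a) * GammaR (x + b) < GammaR x * GammaR (x + a + b).
Proof.
move=> x0 a0 b0.
have xa0 : 0 < x + a by rewrite addr_gt0.
have xb0 : 0 < x + b by rewrite addr_gt0.
have xab0 : 0 < x + a + b by rewrite addr_gt0.
have Gx0 := GammaR_gt0 x0.
pose r := GammaR (x + a) / GammaR x.
have r0 : 0 < r by rewrite divr_gt0// GammaR_gt0.
pose c := r `^ a^-1; have c0 : 0 < c by rewrite powR_gt0.
have cr : c `^ a = r by rewrite /c -powRrM mulVf ?gt_eqF// powRr1// ltW.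
(* q is the value of t^b at the same level c, so both factors in [KE] change sign together there. *)
pose q := c `^ b.
have KE t : 0 < t ->
    gamma_kernel (x + a + b) t - q * gamma_kernel (x + a) t
    - (r * gamma_kernel (x + b) t - r * q * gamma_kernel x t) =
    (t `^ a - r) * (t `^ b - q) * gamma_kernel x t.
  by move=> t0; rewrite !gamma_kernelD//; ring.
suff : r * GammaR (x + b) < GammaR (x + a + b).
  by rewrite -(ltr_pM2l Gx0) mulrA [_ * r]mulrC divfK// gt_eqF.
apply: (@lt_Rintegral_association _ _ _ leb `]0%R, +oo[ `]c, +oo[
  (gamma_kernel x) (gamma_kernel (x + a)) (gamma_kernel (x + b))
  (gamma_kernel (x + a + b)) r q) => //; try exact: integrable_gamma_kernel.
- by move=> t; rewrite /= !in_itv/= !andbT; exact: lt_trans.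
- exact: lebesgue_measure_itvy_gt0.
- by rewrite -[LHS]/(r * GammaR x) divfK// gt_eqF.
- move=> t; rewrite /= in_itv/= andbT => t0; rewrite KE// mulr_ge0//; last first.
    exact/ltW/gamma_kernel_gt0.
  rewrite -cr; have [tc|/ltW ct] := leP t c.
    by rewrite mulr_le0// subr_le0 ge0_ler_powR// ?nnegrE ltW.
  by rewrite mulr_ge0// subr_ge0 ge0_ler_powR// ?nnegrE ltW.
- move=> t; rewrite /= in_itv/= andbT => ct; have t0 := lt_trans c0 ct.
  rewrite KE// mulr_gt0 ?gamma_kernel_gt0// -cr.
  by rewrite mulr_gt0// subr_gt0 gt0_ltr_powR// nnegrE ltW.
Qed.

Lemma rising_gt0 x (b : R) : 0 < x -> 0 <= b -> 0 < rising x b.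
Proof.
by move=> x0 b0; rewrite /rising gt_eqF// divr_gt0 ?GammaR_gt0// ltr_wpDr.
Qed.

(** The case x = 0 is the convention 0_(0) = 1; it serves the factors of the MGWD product where
    m(A_i) = 0. *)
Lemma rising0 x : 0 <= x -> rising x 0 = 1.
Proof.
rewrite le0r /rising => /predU1P[->|x0]; first by rewrite !eqxx.
by rewrite gt_eqF// addr0 divff// gt_eqF// GammaR_gt0.
Qed.

(** With denominators cleared, this is [GammaR_cross_lt] at rho + s with increments a and t - s. *)
Lemma rising_ratio_decr (rho a s t : R) : 0 < rho -> 0 < a -> 0 <= s -> s < t ->
  rising rho t / rising (rho + a) t < rising rho s / rising (rho + a) s.
Proof.
move=> rho0 a0 s0 st; have t0 : 0 <= t := ltW (le_lt_trans s0 st).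
have ra0 : 0 < rho + a by rewrite addr_gt0.
rewrite ltr_pdivrMr ?rising_gt0// mulrAC ltr_pdivlMr ?rising_gt0//.
rewrite /rising !(gt_eqF rho0) !(gt_eqF ra0).
rewrite mulrACA [ltRHS]mulrACA ltr_pM2r ?mulr_gt0 ?invr_gt0 ?GammaR_gt0//.
have rs0 : 0 < rho + s by rewrite ltr_wpDr.
have ts0 : 0 < t - s by rewrite subr_gt0.
have := GammaR_cross_lt rs0 a0 ts0.
have -> : rho + s + a = rho + a + s by ring.
have -> : rho + s + (t - s) = rho + t by ring.
have -> : rho + a + s + (t - s) = rho + a + t by ring.
by rewrite mulrC.
Qed.
End GammaMonotonicity.

(** * Extension of a content from the bounded Borel sets to a measure *)

Section BoundedBorelSets.
Context {R : realType} {S : pmetricType R}.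

Lemma Borel_open (A : set S) : open A -> Borel A.
Proof. exact: sub_sigma_algebra. Qed.

Lemma open_mdist_lt (x : S) (r : R) : open [set y | mdist x y < r].
Proof.
rewrite openE => y /= xyr; apply/nbhs_ballP; exists (r - mdist x y) => /=.
  by rewrite subr_gt0.
move=> z; rewrite ballEmdist /= ltrBrDl; apply: le_lt_trans.
exact: metric_triangle.
Qed.

Lemma Borel_set1 (x : S) : Borel [set x].
Proof.
rewrite -[X in Borel X]setCK; apply: measurableC; apply: sub_sigma_algebra.
apply: closed_openC; apply: accessible_closed_set1.
exact/hausdorff_accessible/metric_hausdorff.
Qed.

Lemma mbounded_subset (A B : set S) : A `<=` B -> mbounded B -> mbounded A.
Proof. by move=> AB [x [r Br]]; exists x, r; exact: subset_trans Br. Qed.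

Lemma mbounded_set1 (x : S) : mbounded [set x].
Proof. by exists x, 1 => _ -> /=; rewrite mdistxx. Qed.

Lemma bBorel_set0 : bBorel (set0 : set S).
Proof. by split; [exact: measurable0|exists point, 0 => ?]. Qed.

(** The shell of points at distance in [n, n+1[ from [point]; the shells partition S into bounded
    Borel sets. *)
Definition annulus : nat -> set S :=
  seqDU (fun n => [set y : S | mdist point y < n.+1%:R]).

Lemma bBorel_annulus n : bBorel (annulus n).
Proof.
have bB i : Borel [set y : S | mdist point y < i.+1%:R].
  by apply: Borel_open; exact: open_mdist_lt.
split; last first.
  by exists point, n.+1%:R; exact: subset_seqDU.
apply: measurableD; first exact: bB.
by apply: bigsetU_measurable => i _; exact: bB.
Qed.

Lemma bigcup_annulus : \bigcup_n annulus n = setT.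
Proof.
rewrite -seqDU_bigcup_eq; apply/seteqP; split => // y _.
by exists (Num.trunc (mdist point y)) => //=; exact: truncnS_gt.
Qed.

(* A content on the bounded Borel sets that is countably additive there is
   glued from its restrictions to the annuli; the absolute value only makes the
   restrictions nonnegative on the sets where [m] is unconstrained. *)
Lemma measure_of_bBorel (m : set S -> R) :
  m set0 = 0 -> (forall A, bBorel A -> 0 <= m A) ->
  (forall F : nat -> set S, (forall i, Borel (F i)) -> trivIset setT F ->
    mbounded (\bigcup_i F i) ->
    (\sum_(i <oo) (m (F i))%:E = (m (\bigcup_i F i))%:E)%E) ->
  exists mu : {measure set (BorelT S) -> \bar R},
    forall A, bBorel A -> mu A = (m A)%:E.
Proof.
move=> m0 m_ge0 m_sigma.
pose loc n (A : set (BorelT S)) := (`|m (A `&` annulus n)|%:E)%E.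
have bI (A : set S) n : Borel A -> bBorel (A `&` annulus n).
  move=> BA; have [Ban ban] := bBorel_annulus n.
  by split; [exact: measurableI|exact: mbounded_subset ban].
have loc0 n : loc n set0 = 0%E by rewrite /loc set0I m0 normr0.
have loc_ge0 n A : (0 <= loc n A)%E by rewrite lee_fin.
(* Traces on a fixed shell have a bounded union, so the additivity of [m] applies even to unbounded
   [F i]. *)
have loc_sigma n : semi_sigma_additive (loc n).
  move=> F mF tF mUF.
  have -> : loc n (\bigcup_i F i) = (\sum_(i <oo) loc n (F i))%E.
    rewrite /loc ger0_norm; last by apply: m_ge0; exact: bI.
    rewrite setI_bigcupl -m_sigma.
    - by apply: eq_eseriesr => i _; rewrite ger0_norm//; apply: m_ge0; exact: bI (mF i).
    - by move=> i; have [] := bI (F i) n (mF i).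
    - exact: trivIset_setIr.
    - rewrite -setI_bigcupl.
      by have [] := bI _ n mUF.
  exact: is_cvg_nneseries.
pose mun n : {measure set (BorelT S) -> \bar R} :=
  HB.pack (loc n) (isMeasure.Build _ _ _ (loc n) (loc0 n) (loc_ge0 n) (loc_sigma n)).
exists (mseries mun 0) => A [BA bA]; rewrite /mseries.
(* The traces of a bounded A on the shells are disjoint with bounded union A, so their contents sum
   back to m(A). *)
have AE : A = \bigcup_n (A `&` annulus n).
  by rewrite -setI_bigcupr bigcup_annulus setIT.
rewrite {2}AE -m_sigma.
- apply: eq_eseriesr => i _; rewrite -[LHS]/(loc i A) /loc ger0_norm//.
  by apply: m_ge0; exact: bI.
- by move=> i; have [] := bI A i BA.
- exact/trivIset_setIl/trivIset_seqDU.
- by rewrite -AE.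
Qed.

End BoundedBorelSets.

(** * Void probabilities and countable additivity of m *)

Section VoidProbability.
Context {R : realType} {S : pmetricType R} {d : measure_display}
  {Omega : measurableType d} (P : probability Omega R)
  (N : Omega -> {measure set (BorelT S) -> \bar R})
  (m : set S -> R) (a rho k : R)
  (a0 : 0 < a) (rho0 : 0 < rho) (k0 : 0 < k) (ppN : point_process N)
  (m_ge0 : forall A : set S, bBorel A -> 0 <= m A)
  (mgwdN : forall (l : nat) (A : 'I_l -> set S),
      (forall i, bBorel (A i)) ->
      (forall i j, i != j -> A i `&` A j = set0) ->
      forall x : 'I_l -> nat,
        P [set w | forall i, N w (A i) = ((x i)%:R)%:E] =
        (mgwd_pmf a (fun i => k * m (A i)) rho x)%:E).

(** The void probability of a bounded Borel set as a function of its content. *)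
Let phi (t : R) := rising rho (k * t) / rising (rho + a) (k * t).

Let phi_decr s t : 0 <= s -> s < t -> phi t < phi s.
Proof.
by move=> s0 st; apply: rising_ratio_decr; rewrite ?mulr_ge0 ?(ltW k0)// ltr_pM2l.
Qed.

Let phi_le s t : 0 <= s -> 0 <= t -> (phi t <= phi s) = (s <= t).
Proof.
move=> s0 t0; apply/idP/idP; first by apply: contraTT; rewrite -!ltNge; exact: phi_decr.
by rewrite le_eqVlt => /predU1P[->//|st]; exact/ltW/phi_decr.
Qed.

Lemma void_probability_fin (l : nat) (A : 'I_l -> set S) :
  (forall i, bBorel (A i)) -> (forall i j, i != j -> A i `&` A j = set0) ->
  P [set w | forall i, N w (A i) = 0%E] = (phi (\sum_(i < l) m (A i)))%:E.
Proof.
move=> bA tA; have := mgwdN bA tA (fun=> 0%N) => ->; congr EFin.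
have n0 : \sum_(i < l) ((fun=> 0%N) i)%:R = 0 :> R by rewrite big1.
rewrite /mgwd_pmf -mulr_sumr n0 addr0.
rewrite (rising0 (ltW a0)) (mulr1 (rising rho _)).
rewrite [\prod_(i < l) _]big1 ?mulr1// => i _; rewrite rising0 ?divr1//.
by rewrite mulr_ge0 ?m_ge0// ltW.
Qed.

Lemma void_probability (A : set S) : bBorel A ->
  P [set w | N w A = 0%E] = (phi (m A))%:E.
Proof.
move=> bA; have := @void_probability_fin 1 (fun=> A) (fun=> bA).
rewrite big_ord1 => <-; last by move=> i j; rewrite !ord1 eqxx.
by congr (P _); apply/seteqP; split => w; [move=> ? _|move=> /(_ ord0)].
Qed.

Let measurable_void (A : set S) : Borel A -> measurable [set w | N w A = 0%E].
Proof.
move=> BA; rewrite -[X in measurable X]setTI.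
exact: (ppN.2 A BA measurableT [set 0%E] (emeasurable_set1 0%E)).
Qed.

(** Since phi(0) = 1 and phi is strictly decreasing, phi(m(A)) = 1 forces m(A) <= 0. This serves the
    empty set and the singletons. *)
Lemma void_content0 (A : set S) : bBorel A -> P [set w | N w A = 0%E] = 1%E ->
  m A = 0.
Proof.
move=> bA; rewrite void_probability// => -[phi1].
apply/eqP; rewrite eq_le (m_ge0 bA) andbT -(phi_le (m_ge0 bA) (lexx 0)).
by rewrite phi1 /phi mulr0 !rising0 ?divr1// ltW// addr_gt0.
Qed.

Lemma void_content_sigma_additive (F : nat -> set S) :
  (forall i, Borel (F i)) -> trivIset setT F -> mbounded (\bigcup_i F i) ->
  (\sum_(i <oo) (m (F i))%:E = (m (\bigcup_i F i))%:E)%E.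
Proof.
move=> BF tF bUF.
have bF i : bBorel (F i).
  by split=> //; apply: mbounded_subset bUF; exact: bigcup_sup.
have bU : bBorel (\bigcup_i F i) by split=> //; exact: bigcupT_measurable.
pose E n := [set w | forall i : 'I_n, N w (F i) = 0%E].
have EE n : E n = \bigcap_(i in `I_n) [set w | N w (F i) = 0%E].
  apply/seteqP; split => [w Ew i/= ni|w Ew i]; first exact: (Ew (Ordinal ni)).
  exact: (Ew i (ltn_ord i)).
have mE n : measurable (E n).
  by rewrite EE; apply: bigcap_measurableType => i _; exact: measurable_void.
have PE n : P (E n) = (phi (\sum_(i < n) m (F i)))%:E.
  apply: void_probability_fin => // i j ij; exact: (iffLR trivIsetP tF).
have capE : \bigcap_n E n = [set w | N w (\bigcup_i F i) = 0%E].
  apply/seteqP; split => [w Ew|w Nw0 n _ i] /=.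
    rewrite measure_semi_bigcup//; last exact: bU.1.
    rewrite eseries0// => i _ _.
    (* [E n] constrains only the indices below n, so index i is read off as the last one of
       [E i.+1]. *)
    exact: (Ew i.+1 I ord_max).
  apply/eqP; rewrite -measure_le0 -Nw0; apply: le_measure; rewrite ?inE//.
  - exact: BF.
  - exact: bU.1.
  - exact: bigcup_sup.
have PEcvg : P \o E @ \oo --> (phi (m (\bigcup_i F i)))%:E.
  rewrite -(void_probability bU) -capE; apply: nonincreasing_cvg_mu => //.
  - by rewrite (le_lt_trans (probability_le1 P _))// ltry.
  - exact: bigcapT_measurable.
  - move=> p q pq; apply/subsetPset; rewrite !EE => w Ew i /= ip.
    by apply: Ew => /=; exact: leq_trans pq.
have m0 i : 0 <= m (F i) := m_ge0 (bF i).
have s0 n : 0 <= \sum_(i < n) m (F i) by apply: sumr_ge0.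
(* The intersection lies in [E n], so phi of the total content is at most phi of the partial sum;
   phi reverses the order. *)
have partial_le n : (\sum_(0 <= i < n) (m (F i))%:E <= (m (\bigcup_i F i))%:E)%E.
  rewrite sumEFin lee_fin big_mkord -(phi_le (s0 n) (m_ge0 bU)).
  have : (P (\bigcap_n E n) <= P (E n))%E.
    rewrite le_measure ?inE//; first exact: bigcapT_measurable.
    exact: bigcap_inf.
  by rewrite capE (void_probability bU) PE lee_fin.
have cvgs : cvgn (fun n => \sum_(0 <= i < n) (m (F i))%:E)%E.
  by apply: is_cvg_nneseries => i _ _; rewrite lee_fin.
have le1 : (\sum_(i <oo) (m (F i))%:E <= (m (\bigcup_i F i))%:E)%E.
  by apply: lime_le => //; exact: nearW.
apply/eqP; rewrite eq_le le1/=.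
have ge0 : (0 <= \sum_(i <oo) (m (F i))%:E)%E.
  by apply: nneseries_ge0 => i _ _; rewrite lee_fin.
(* Finiteness turns the series into a real s, at which phi can be evaluated. *)
have : (\sum_(i <oo) (m (F i))%:E)%E \is a fin_num.
  by rewrite ge0_fin_numE// (le_lt_trans le1)// ltry.
move=> /fineK; move: ge0; set s := fine _ => + sE.
rewrite -sE !lee_fin => s_ge0; rewrite -(phi_le (m_ge0 bU) s_ge0).
(* For the reverse inequality, each partial sum is at most s, so phi(s) <= P(E n) for all n, and
   this passes to the limit. *)
suff : ((phi s)%:E <= lim (P \o E @ \oo))%E by rewrite (cvg_lim _ PEcvg)// lee_fin.
apply: lime_ge; first by apply/cvg_ex; eexists; exact: PEcvg.
apply: nearW => n; rewrite /= PE lee_fin (phi_le (s0 n) s_ge0) -lee_fin sE.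
rewrite -sumEFin -(big_mkord xpredT (fun i => (m (F i))%:E)).
by apply: nneseries_lim_ge => i _ _; rewrite lee_fin.
Qed.

End VoidProbability.

(** * Existence of the nonatomic measure *)

Theorem theorem5 (R : realType) (S : pmetricType R)
  (d : measure_display) (Omega : measurableType d) (P : probability Omega R)
  (N : Omega -> {measure set (BorelT S) -> \bar R})
  (m : set S -> R) (a rho k : R) :
  complete_space S -> separable_space S ->
  0 < a -> 0 < rho -> 0 < k ->
  point_process N ->
  (* (I) almost surely boundedly finite, no fixed atoms *)
  {ae P, forall w, forall A : set S, bBorel A -> (N w A < +oo)%E} ->
  (forall x : S, P [set w | (0 < N w [set x])%E] = 0%E) ->
  (* (II) m : bounded Borel sets -> [0, oo), finite-dimensional MGWD laws *)
  (forall A : set S, bBorel A -> 0 <= m A) ->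
  (forall (l : nat) (A : 'I_l -> set S),
      (forall i, bBorel (A i)) ->
      (forall i j, i != j -> A i `&` A j = set0) ->
      forall x : 'I_l -> nat,
        P [set w | forall i, N w (A i) = ((x i)%:R)%:E] =
        (mgwd_pmf a (fun i => k * m (A i)) rho x)%:E) ->
  exists mu : {measure set (BorelT S) -> \bar R},
    (forall A : set S, bBorel A -> (mu A < +oo)%E) /\
    (forall x : S, mu [set x] = 0%E) /\
    (forall A : set S, bBorel A ->
       mu A = (m A)%:E /\
       P [set w | N w A = 0%E] =
       (rising rho (k * fine (mu A)) / rising (rho + a) (k * fine (mu A)))%:E).
Proof.
move=> _ _ a0 rho0 k0 ppN _ no_atom m_ge0 mgwdN.
have m0 : m set0 = 0.
  apply: (void_content0 a0 rho0 k0 m_ge0 mgwdN bBorel_set0).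
  rewrite (_ : [set w | _] = setT) ?probability_setT//.
  by apply/seteqP; split => w //= _; rewrite measure0.
have m1 x : m [set x] = 0.
  have Bx := Borel_set1 x.
  apply: (void_content0 a0 rho0 k0 m_ge0 mgwdN).
    by split; [|exact: mbounded_set1].
  (* As N takes nonnegative values, being void at x is the complement of having an atom there. *)
  have -> : [set w | N w [set x] = 0%E] = ~` [set w | (0 < N w [set x])%E].
    apply/seteqP; split => w /=; first by move=> ->; rewrite ltxx.
    by move=> /negP; rewrite measure_gt0 negbK => /eqP.
  rewrite probability_setC ?no_atom ?sube0//.
  rewrite -[X in measurable X]setTI.
  exact: (emeasurable_fun_o_infty measurableT (ppN.2 _ Bx)).
have [mu muE] := measure_of_bBorel m0 m_ge0
  (void_content_sigma_additive a0 rho0 k0 ppN m_ge0 mgwdN).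
exists mu; split; [|split] => [A bA|x|A bA].
- by rewrite muE// ltry.
- by rewrite muE ?m1//; split; [exact: Borel_set1|exact: mbounded_set1].
- by rewrite muE//=; split=> //; exact: void_probability.
Qed.
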